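(* Let $a_{i_1}\cdots a_{i_k}$ and $a_{i_1}\cdots a_{i_k}a_j$ both be reduced words (for consecutive permutations in $S_{n+1}$), let $\varepsilon_1,\ldots,\varepsilon_k,\varepsilon\in\{\pm1\}$, and set $z_1=(\acute a_{i_1})^{\varepsilon_1}\cdots(\acute a_{i_k})^{\varepsilon_k}$ and $z_0=z_1(\acute a_j)^{\varepsilon}$ in $\widetilde{\mathrm B}^+_{n+1}$. For every $q\in\operatorname{Quat}_{n+1}$, $$\overline{\operatorname{Bru}_{qz_1}}\subset\overline{\operatorname{Bru}_{qz_0}}$$ (closures in $\operatorname{Spin}_{n+1}$).
   Context: Fix an integer $n\ge2$. $S_{n+1}$ is the group of permutations of $\{1,\ldots,n+1\}$ acting on the right, $(\sigma,k)\mapsto k^\sigma$, so $k^{\sigma_1\sigma_2}=(k^{\sigma_1})^{\sigma_2}$; it is generated by $a_j=(j,j+1)$, $1\le j\le n$. $\operatorname{inv}(\sigma)$ is the number of pairs $i<j$ with $i^\sigma>j^\sigma$; a reduced word for $\sigma$ is an expression $\sigma=a_{i_1}\cdots a_{i_k}$ with $k=\operatorname{inv}(\sigma)$. $\Pi:\operatorname{Spin}_{n+1}\to\operatorname{SO}_{n+1}$ is the universal (double) covering homomorphism. Let $\mathfrak a_j\in\mathfrak{so}_{n+1}$ have nonzero entries only $(\mathfrak a_j)_{j+1,j}=1$, $(\mathfrak a_j)_{j,j+1}=-1$. Identifying the Lie algebra of $\operatorname{Spin}_{n+1}$ with $\mathfrak{so}_{n+1}$ via $\Pi$, let $\alpha_j(\theta)=\exp(\theta\mathfrak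 a_j)\in\operatorname{Spin}_{n+1}$ and $\acute a_j=\alpha_j(\pi/2)$. $\mathrm B^+_{n+1}\subset\operatorname{SO}_{n+1}$ is the group of signed permutation matrices of determinant $1$, and $\operatorname{Diag}^+_{n+1}\subset \mathrm B^+_{n+1}$ is the subgroup of diagonal matrices. $\widetilde{\mathrm B}^+_{n+1}=\Pi^{-1}[\mathrm B^+_{n+1}]$, $\operatorname{Quat}_{n+1}=\Pi^{-1}[\operatorname{Diag}^+_{n+1}]$. $\operatorname{Up}^+_{n+1}$ is the group of real upper triangular $(n+1)\times(n+1)$ matrices with strictly positive diagonal entries. For $z\in\widetilde{\mathrm B}^+_{n+1}$ with $P=\Pi(z)$, the signed Bruhat cell $\operatorname{Bru}_z\subset\operatorname{Spin}_{n+1}$ is the connected component containing $z$ of $\Pi^{-1}\big[(\operatorname{Up}^+_{n+1}P\operatorname{Up}^+_{n+1})\cap\operatorname{SO}_{n+1}\big]$. *)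

(* Defs.v *)
From HB Require Import structures.
From mathcomp Require Import all_boot all_order all_algebra fingroup perm.
From mathcomp Require Import all_classical all_reals all_analysis.

Set Implicit Arguments.
Unset Strict Implicit.
Unset Printing Implicit Defensive.

Import Order.TTheory GRing.Theory Num.Theory.
Import numFieldNormedType.Exports.

Local Open Scope classical_set_scope.
Local Open Scope ring_scope.

HB.mixin Record isTopologicalGroup G of Topological G & monoid.Group G := {
  mulg_continuous : continuous (fun p : G * G => (p.1 * p.2)%g) ;
  invg_continuous : continuous (fun x : G => (x^-1)%g)
}.

#[short(type="topGroupType")]
HB.structure Definition TopologicalGroup :=
  {G of isTopologicalGroup G & Topological G & monoid.Group G}.

(** ** Coverings and simple connectedness *)

(* An open map that is injective on an open sheet is a homeomorphism of the
   sheet onto its image, as [p] is continuous. *)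
Definition covering_map (X Y : topologicalType) (p : X -> Y) : Prop :=
  [/\ continuous p,
      (forall y, exists x, p x = y)
    & forall y, exists U : set Y, [/\ open U, U y &
        exists (I : Type) (V : I -> set X),
          [/\ p @^-1` U = \bigcup_i V i,
              trivIset setT V,
              forall i, open (V i),
              forall i, set_bij (V i) U p
            & forall i (W : set X), open W -> W `<=` V i -> open (p @` W)]]].

Section SimplyConnected.
Context (R : realType) (X : topologicalType).

Definition joined (x y : X) : Prop :=
  exists g : R -> X,
    [/\ {within `[0, 1], continuous g}, g 0 = x & g 1 = y].

Definition null_homotopic (x : X) (g : R -> X) : Prop :=
  exists H : R * R -> X,
    [/\ {within `[0, 1] `*` `[0, 1], continuous H},
        forall t, t \in `[0, 1] -> H (0, t) = g t,
        forall t, t \in `[0, 1] -> H (1, t) = x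
      & forall s, s \in `[0, 1] -> H (s, 0) = x /\ H (s, 1) = x].

Definition simply_connected : Prop :=
  (forall x y, joined x y) /\
  (forall (x : X) (g : R -> X),
     {within `[0, 1], continuous g} -> g 0 = x -> g 1 = x ->
     null_homotopic x g).

End SimplyConnected.

(** ** Matrix groups *)

Section Matrices.
Context (R : realType) (m : nat).
Implicit Types A P U : 'M[R]_m.

(* Used as a type, [SO] carries the subtype topology of ['M[R]_m]. *)
Definition SO : set 'M[R]_m := [set A | A *m A^T = 1%:M /\ \det A = 1].

Definition so : set 'M[R]_m := [set A | A^T = - A].

Definition signed_perm_mx P : Prop :=
  exists (s : 'S_m) (e : 'I_m -> bool),
    P = \matrix_(i, j) (if j == s i then (-1) ^+ e i else 0).

Definition Bplus : set 'M[R]_m := [set P | signed_perm_mx P /\ \det P = 1].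

Definition Diagplus : set 'M[R]_m := [set P | Bplus P /\ is_diag_mx P].

Definition Upplus : set 'M[R]_m :=
  [set U | (forall i j : 'I_m, (j < i)%N -> U i j = 0) /\
           (forall i : 'I_m, 0 < U i i)].

Definition bruhat_SO P : set 'M[R]_m :=
  [set U1 *m P *m U2 | U1 in Upplus & U2 in Upplus] `&` SO.

End Matrices.

Arguments SO : clear implicits.

(** ** The symmetric group *)

(* The product of ['S_m] is [(s * t) x = t (s x)], so that it acts on the
   right. *)
Definition inv_perm (m : nat) (s : 'S_m) : nat :=
  #|[pred p : 'I_m * 'I_m | (p.1 < p.2)%N && (s p.2 < s p.1)%N]|.

(* Indices are zero-based: [j : 'I_n] stands for [a_(j+1) = (j+1, j+2)]. *)
Definition coxeter_gen (n : nat) (j : 'I_n) : 'S_n.+1 :=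
  tperm (widen_ord (leqnSn n) j) (lift ord0 j).

Definition reduced_word (n : nat) (w : seq 'I_n) : Prop :=
  inv_perm (\prod_(j <- w) coxeter_gen j)%g = size w.

(** ** The spin group *)

Definition a_mx (R : realType) (n : nat) (j : 'I_n) : 'M[R]_n.+1 :=
  delta_mx (lift ord0 j) (widen_ord (leqnSn n) j)
  - delta_mx (widen_ord (leqnSn n) j) (lift ord0 j).

(* [G] with [Pi] is Spin_{n+1}: the universal covering group of SO_{n+1}, which
   is determined up to unique isomorphism over SO_{n+1}.  For [n >= 2] the
   fundamental group of SO_{n+1} is Z/2, so that the covering is double. *)
Definition universal_covering_hom (R : realType) (m : nat) (G : topGroupType)
    (Pi : G -> SO R m) : Prop :=
  [/\ forall x y, set_val (Pi (x * y)%g) = set_val (Pi x) *m set_val (Pi y),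
      covering_map Pi
    & simply_connected R G].

Section Spin.
Context (R : realType) (n : nat) (G : topGroupType) (Pi : G -> SO R n.+1).

(* The exponential map of the Lie group [G], whose Lie algebra is identified
   with [so] by the differential of [Pi] at the identity: for [X] in [so],
   [t |-> e (t X)] is the one-parameter subgroup with initial velocity [X].
   Values of [e] outside [so] are irrelevant. *)
Definition exponential_map (e : 'M[R]_n.+1 -> G) : Prop :=
  forall X, so X ->
    [/\ continuous (fun t : R => e (t *: X)),
        forall s t : R, e ((s + t) *: X) = (e (s *: X)%R * e (t *: X)%R)%g
      & is_derive (0 : R) (1 : R)
          (fun t : R => set_val (Pi (e (t *: X))) : 'M[R]_n.+1) X].

Definition alpha (e : 'M[R]_n.+1 -> G) (j : 'I_n) (theta : R) : G :=
  e (theta *: a_mx R j).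

Definition acute (e : 'M[R]_n.+1 -> G) (j : 'I_n) : G := alpha e j (pi / 2).

Definition Btilde : set G := [set z | Bplus (set_val (Pi z))].

Definition Quat : set G := [set z | Diagplus (set_val (Pi z))].

(* Meant for [z] in [Btilde]. *)
Definition Bru (z : G) : set G :=
  connected_component [set x | bruhat_SO (set_val (Pi z)) (set_val (Pi x))] z.

End Spin.

(* A sign is encoded by a boolean [b] standing for [(-1) ^ b]. *)
Definition sign_pow (G : groupType) (x : G) (b : bool) : G :=
  if b then (x^-1)%g else x.

(* Main.v *)
Require Import Defs.
From HB Require Import structures.
From mathcomp Require Import all_boot all_order all_algebra fingroup perm.
From mathcomp Require Import all_classical all_reals all_analysis.
From mathcomp Require Import zify ring lra.

(** Let [x] lie in the cell of [z = q z1], and let [e] be the sign of the last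
    letter. It is enough to show that the points [x * alpha_j (e t)] with
    [0 < t < pi] lie in the cell of [z0 = z * alpha_j (e pi / 2)], since they
    tend to [x] as [t] tends to [0].

    Write [P] for the matrix of [z] and [U1 P U2] for that of [x]. The matrix of
    [alpha_j (e t)] is a plane rotation acting on the consecutive coordinates
    [a = j] and [b = j + 1]. As [sin t > 0], the Bruhat decomposition in that
    plane gives [U2 * rot (e t) = (1 + c E_ab) * rot (e pi / 2) * N] with [N] in
    [Upplus] ([Upplus_plane_rot]). Moving the elementary factor across [P] turns
    it into [1 + c P E_ab P^T]. If [w] is the permutation underlying [P], this
    is upper unitriangular for all [c] exactly when [w^-1 a < w^-1 b]
    ([conj_delta_Upplus]). This inequality says that multiplying [w] by [a_j]
    increases the length, which is what the two reduced words provide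
    ([inv_perm_mul_coxeter_gen]). Hence the matrix of [x * alpha_j (e t)] is in
    the double coset of [P * rot (e pi / 2)], the matrix of [z0]
    ([bruhat_SO_mul_alpha]).

    To reach the component of [z0], translate the cell of [z] by
    [alpha_j (e pi / 2)]: this is a connected set through [z0], and it meets the
    arc [x * alpha_j (e t)], [0 < t < pi], at [t = pi / 2]
    ([Bru_sub_closure]).

    That [alpha_j] projects to plane rotations is a uniqueness statement for the
    differential equation [M' = M X], solved entry by entry
    ([plane_rot_one_param]). *)

Set Implicit Arguments.
Unset Strict Implicit.
Unset Printing Implicit Defensive.

Import Order.TTheory GRing.Theory Num.Theory.
Import numFieldNormedType.Exports.

Local Open Scope classical_set_scope.
Local Open Scope ring_scope.

Local Notation low j := (widen_ord (leqnSn _) j).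
Local Notation high j := (lift ord0 j).

(** * Lengths of permutations *)

(** Exchanging the adjacent values [low j] and [high j] can only create an
    inversion between the two positions holding them, and does so only if they
    occur in increasing order. *)
Lemma inv_perm_mul_coxeter_gen (n : nat) (s : 'S_n.+1) (j : 'I_n) :
  (inv_perm s < inv_perm (s * coxeter_gen j)%g)%N ->
  ((s^-1)%g (low j) < (s^-1)%g (high j))%N.
Proof.
apply: contraTT; rewrite -!leqNgt => le_high_low.
apply: subset_leq_card; apply/fintype.subsetP.
move=> [p r]; rewrite !inE /= !permM => /andP[lt_pr +]; rewrite lt_pr /=.
have highE : high j = (low j).+1 :> nat by [].
have valE (x y : 'I_n.+1) : x <> y -> (x : nat) <> y by move=> + /val_inj.
case: tpermP => [sr|sr|/valE sr /valE sr'];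
  case: tpermP => [sp|sp|/valE sp /valE sp'].
all: try (rewrite ?sr ?sp; lia).
(* The remaining case is the pair of positions holding the exchanged values. *)
by move: le_high_low; rewrite -sp -sr !permK leqNgt lt_pr.
Qed.

(** * Upper triangular matrices and plane rotations *)

Section Upper.
Context (R : realType) (m : nat).
Implicit Types U V P : 'M[R]_m.

Lemma Upplus1 : Upplus (1%:M : 'M[R]_m).
Proof.
split=> [i l li|i]; rewrite mxE ?eqxx //.
by rewrite -val_eqE /= gtn_eqF.
Qed.

Lemma Upplus_mul U V : Upplus U -> Upplus V -> Upplus (U *m V).
Proof.
move=> [U0 Ugt0] [V0 Vgt0]; split=> [i l li|i]; rewrite mxE.
  apply: big1 => k _; case: (ltnP k i) => [/U0 ->|ik]; first by rewrite mul0r.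
  by rewrite V0 ?mulr0 // (leq_trans li).
rewrite (bigD1 i) //= big1 ?addr0 ?mulr_gt0 // => k.
rewrite neq_ltn => /orP[/U0 ->|/V0 ->]; first by rewrite mul0r.
by rewrite mulr0.
Qed.

(** [P] is monomial, with possibly zero coefficients, over the permutation
    matrix of [s]. This keeps track of the permutation underlying a product of
    signed permutation matrices without following the signs. *)
Definition mx_support P (s : 'S_m) := forall i l, P i l != 0 -> l = s i.

Lemma mx_supportM P Q s t :
  mx_support P s -> mx_support Q t -> mx_support (P *m Q) (s * t)%g.
Proof.
move=> Ps Qt i l; rewrite mxE permM; apply: contra_neq_eq => lst.
apply: big1 => k _; have [->|/Ps ->] := eqVneq (P i k) 0.
  by rewrite mul0r.
by have [->|/Qt/eqP] := eqVneq (Q (s i) l) 0; rewrite ?mulr0 ?(negPf lst).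
Qed.

Lemma mx_support_diag P : is_diag_mx P -> mx_support P 1%g.
Proof.
move=> /is_diag_mxP dP i l; rewrite perm1; apply: contra_neq_eq => nli.
by apply: dP; rewrite eq_sym.
Qed.

(** For [P] supported on [s], the matrix [P E_ab P^T] has its only possibly
    nonzero entry at row [s^-1 a] and column [s^-1 b], which the hypothesis
    places above the diagonal. *)
Lemma conj_delta_Upplus P s (a b : 'I_m) t : mx_support P s ->
  ((s^-1)%g a < (s^-1)%g b)%N ->
  Upplus (1%:M + t *: (P *m delta_mx a b *m P^T)).
Proof.
move=> Ps lt_ab.
have Z (i l : 'I_m) : (l <= i)%N -> (P *m delta_mx a b *m P^T) i l = 0.
  move=> li; rewrite -mulmxA !mxE big1 // => k _; rewrite !mxE.
  have [->|/Ps ->] := eqVneq (P i k) 0; first by rewrite mul0r.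
  rewrite big1 ?mulr0 // => h _; rewrite !mxE.
  case: eqP => [sia|_]; last by rewrite mul0r.
  case: eqP => [->|_]; last by rewrite mul0r.
  have [->|/Ps blk] := eqVneq (P l b) 0; first by rewrite mulr0.
  by move: lt_ab; rewrite -sia blk !permK ltnNge li.
split=> [i l li|i].
  by rewrite 3!mxE Z ?mulr0 ?addr0 ?(ltnW li) // -(inj_eq val_inj) gtn_eqF.
by rewrite 3!mxE Z // mulr0 addr0 eqxx.
Qed.

End Upper.

Section PlaneRot.
Context (R : realType) (m : nat) (a b : 'I_m).
Hypothesis ab : (b = a.+1 :> nat)%N.

(** The entries are listed by columns, as right multiplication is to be read as
    a column operation: column [a] becomes [c a + s b] and column [b] becomes
    [c b - s a]. *)
Definition plane_rot (c s : R) : 'M[R]_m := \matrix_(i, l)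
  if l == a then c * (i == a)%:R + s * (i == b)%:R
  else if l == b then c * (i == b)%:R - s * (i == a)%:R
  else (i == l)%:R.

Let ba_neq : b == a = false.
Proof. by apply/eqP => /(congr1 val) /=; rewrite ab; lia. Qed.

Lemma sum_mul_eq (F : 'I_m -> R) (x : 'I_m) :
  \sum_i F i * (i == x)%:R = F x.
Proof.
rewrite (bigD1 x) //= eqxx mulr1 big1 ?addr0 // => i /negPf ->.
by rewrite mulr0.
Qed.

Lemma mulmx_plane_rot p (M : 'M[R]_(p, m)) c s i l : (M *m plane_rot c s) i l =
  if l == a then c * M i a + s * M i b
  else if l == b then c * M i b - s * M i a else M i l.
Proof.
rewrite mxE; under eq_bigr do rewrite mxE.
case: ifP => _; last case: ifP => _; last exact: sum_mul_eq.
- under eq_bigr do rewrite mulrDr !mulrA (mulrC _ c) (mulrC _ s).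
  by rewrite big_split /= !sum_mul_eq.
- under eq_bigr do rewrite mulrBr !mulrA (mulrC _ c) (mulrC _ s).
  by rewrite sumrB /= !sum_mul_eq.
Qed.

Lemma tr_plane_rot c s : (plane_rot c s)^T = plane_rot c (- s).
Proof.
apply/matrixP => i l; rewrite !mxE (eq_sym l i) !mulNr opprK.
have [->|ia] := eqVneq i a; have [->|la] := eqVneq l a; rewrite ?ba_neq //=.
- by rewrite (eq_sym a b) ba_neq !mulr0 oppr0.
- by rewrite (eq_sym a) ba_neq; case: (l == b) => /=; ring.
- rewrite (eq_sym a) ba_neq (negPf ia); case: (i == b) => /=; ring.
- case lb: (l == b); case ib: (i == b); rewrite ?mulr0 ?addr0 ?subr0 //.
  + by rewrite (eqP lb) ib.
  + by rewrite (eqP ib) eq_sym lb.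
Qed.

Lemma plane_rot_mulmx p (M : 'M[R]_(m, p)) c s i l : (plane_rot c s *m M) i l =
  if i == a then c * M a l - s * M b l
  else if i == b then c * M b l + s * M a l else M i l.
Proof.
rewrite -[plane_rot c s *m M]trmxK trmx_mul tr_plane_rot mxE.
by rewrite mulmx_plane_rot !mxE mulNr mulNr opprK.
Qed.

Lemma shear_mulmx p (M : 'M[R]_(m, p)) t i l :
  ((1%:M + t *: delta_mx a b) *m M) i l = M i l + t * ((i == a)%:R * M b l).
Proof.
rewrite mulmxDl mul1mx -scalemxAl 2!mxE; congr (_ + t * _).
rewrite mxE -(sum_mul_eq (fun k => (i == a)%:R * M k l) b).
by apply: eq_bigr => k _; rewrite mxE mulrAC -natrM mulnb.
Qed.

(** The Bruhat decomposition in the plane of [a] and [b]: a 2 x 2 matrix of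
    positive determinant whose lower left entry has the sign [e] is the product
    of an elementary upper matrix, the quarter turn of sign [e] and an upper
    matrix with positive diagonal. The rows of [V] other than [a] and [b] stay
    upper triangular because [a] and [b] are adjacent. *)
Lemma Upplus_plane_rot (V : 'M[R]_m) (c s e : R) : Upplus V ->
  c ^+ 2 + s ^+ 2 = 1 -> e ^+ 2 = 1 -> 0 < e * s ->
  exists t N, Upplus N /\
    V *m plane_rot c s = (1%:M + t *: delta_mx a b) *m plane_rot 0 e *m N.
Proof.
move=> [V0 Vgt0] cs1 e1 es0.
have s0 : s != 0 by apply: contraTneq es0 => ->; rewrite mulr0 ltxx.
set M := V *m plane_rot c s.
have Mba : M b a = s * V b b.
  by rewrite /M mulmx_plane_rot eqxx V0 ?ab // mulr0 add0r.
have Mba0 : M b a != 0 by rewrite Mba mulf_neq0 // gt_eqF.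
(* The multiple of row b that clears the (a, a) entry of M. *)
pose t := M a a / M b a.
(* N is what remains of M after undoing the elementary factor, then the
   quarter turn, whose inverse is its transpose. *)
pose N : 'M[R]_m := \matrix_(i, l) if i == a then e * M b l
  else if i == b then - e * (M a l - t * M b l) else M i l.
have NE i l : N i l = if i == a then e * M b l
    else if i == b then - e * (M a l - t * M b l) else M i l by rewrite mxE.
exists t, N; split; last first.
  apply/matrixP => i l.
  rewrite -mulmxA shear_mulmx !plane_rot_mulmx ba_neq eqxx !NE eqxx ba_neq eqxx.
  case ia: (i == a) => /=; first by rewrite (eqP ia); ring: e1.
  by case ib: (i == b) => /=; rewrite ?(eqP ib); ring: e1.
have Mlo (i l : 'I_m) : (l < i)%N -> (l < a)%N -> M i l = 0.
  move=> li la; rewrite /M mulmx_plane_rot.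
  by rewrite -!val_eqE /= ab !ltn_eqF ?V0 // ltnS ltnW.
have lt_ab : (a < b)%N by rewrite ab.
split=> [i l li|i]; rewrite NE.
  case: eqP => [ia|ia].
    by rewrite ia in li; rewrite Mlo ?mulr0 // ab ltnS ltnW.
  case: eqP => [ib|ib].
    have := li; rewrite ib ab ltnS leq_eqVlt => /orP[/eqP/val_inj ->|la].
      by rewrite /t mulfVK ?subrr ?mulr0.
    by rewrite !Mlo ?mulr0 ?subrr ?mulr0 // ab ltnS ltnW.
  have ia' : i != a by apply/eqP.
  have ib' : i != b by apply/eqP.
  have [la|al] := ltnP l a; first exact: Mlo.
  have ia2 : (a < i)%N := leq_ltn_trans al li.
  have ib2 : (b < i)%N by rewrite ltn_neqAle eq_sym val_eqE ib' ab.
  rewrite /M mulmx_plane_rot !(V0 i) // !mulr0 addr0 subr0.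
  by case: ifP => // _; case: ifP.
case: eqP => [ia|ia].
  by rewrite ia Mba mulrA mulr_gt0.
case: eqP => [ib|ib].
  (* The (b, b) entry is e times the determinant of the 2 x 2 block of M
     divided by its lower left entry, and the rotation has determinant 1. *)
  have -> : - e * (M a i - t * M b i) = e * s * V a a / s ^+ 2.
    rewrite /t ib Mba /M !mulmx_plane_rot eqxx ba_neq eqxx (V0 b a) ?ab //.
    have Vb : V b b != 0 by rewrite gt_eqF.
    rewrite -[in RHS](mulr1 (V a a)) -cs1; field.
    by rewrite s0 Vb.
  by rewrite divr_gt0 ?exprn_even_gt0 // mulr_gt0.
by rewrite /M mulmx_plane_rot; case: eqP => //; case: eqP.
Qed.

End PlaneRot.

(** Multiplying by a rotation whose sine has the sign [e] moves the double coset
    of [P] into that of [P] times the quarter turn of sign [e]; the order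
    condition lets the elementary factor pass to the left of [P]. *)
Lemma double_coset_mul_plane_rot (R : realType) (m : nat) (a b : 'I_m)
    (P Y : 'M[R]_m) (w : 'S_m) (c s e : R) :
  (b = a.+1 :> nat) -> P *m P^T = 1%:M -> mx_support P w ->
  ((w^-1)%g a < (w^-1)%g b)%N ->
  c ^+ 2 + s ^+ 2 = 1 -> e ^+ 2 = 1 -> 0 < e * s ->
  [set U1 *m P *m U2 | U1 in @Upplus R m & U2 in @Upplus R m] Y ->
  [set U1 *m (P *m plane_rot a b 0 e) *m U2
    | U1 in @Upplus R m & U2 in @Upplus R m]
    (Y *m plane_rot a b c s).
Proof.
move=> ab PPt Pw ltab cs1 e1 es0 [U1 U1u [U2 U2u <-]].
have [t [N [Nu eqN]]] := Upplus_plane_rot ab U2u cs1 e1 es0.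
exists (U1 *m (1%:M + t *: (P *m delta_mx a b *m P^T))).
  exact/Upplus_mul/(conj_delta_Upplus _ Pw).
exists N => //; rewrite -[RHS]mulmxA eqN.
rewrite -!mulmxA; congr (U1 *m _); rewrite !mulmxA; congr (_ *m _ *m _).
rewrite mulmxDl mulmxDr mul1mx mulmx1 -scalemxAl -scalemxAr.
by rewrite -[_ *m P]mulmxA (mulmx1C PPt) mulmx1.
Qed.

Lemma mx_support_plane_rot (R : realType) (n : nat) (j : 'I_n) (e : R) :
  mx_support (plane_rot (low j) (high j) 0 e) (coxeter_gen j).
Proof.
move=> i l; rewrite mxE !mul0r add0r sub0r; case: ifP => [/eqP -> | la].
  by case: (i =P high j) => [->|_]; rewrite ?tpermR // mulr0 eqxx.
case: ifP => [/eqP -> | lb].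
  by case: (i =P low j) => [->|_]; rewrite ?tpermL // mulr0 oppr0 eqxx.
case: (i =P l) => [->|_]; rewrite ?eqxx // => _.
by rewrite tpermD // eq_sym ?la ?lb.
Qed.

(** * One-parameter groups of rotations *)

Section OneParameter.
Context (R : realType) (n : nat) (M : R -> 'M[R]_n.+1) (X : 'M[R]_n.+1).
Hypothesis MD : forall s t, M (s + t) = M s *m M t.
Hypothesis dM0 : is_derive (0 : R) (1 : R) M X.

(** The homomorphism property carries the derivative at [0] to every time: this
    is the equation [M' = M X], read entrywise. *)
Lemma is_derive_one_param t i l :
  is_derive t (1 : R) (fun u => M u i l) ((M t *m X) i l).
Proof.
have d0 k : is_derive (0 : R) (1 : R) (fun u => M u k l) (X k l).
  case: dM0 => dM0' <-; split; first by move/derivable_mxP : dM0'; apply.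
  by rewrite derive_mx // mxE.
have -> : (fun u => M u i l) =
    \sum_(k < n.+1) (M t i k \*: ((fun u => M u k l) \o shift (- t))).
  by apply/funext => u; rewrite fct_sumE -{1}(subrK t u) addrC MD mxE.
rewrite mxE; apply: is_derive_sum => k.
apply: is_deriveZ; rewrite -[X k l]mulr1; apply: is_derive1_comp.
  by rewrite /shift subrr.
exact: is_derive_shift.
Qed.

End OneParameter.

(** The equation [M' = M X] leaves all columns constant but [low j] and
    [high j], and in each row the entries [A], [B] of these two columns solve
    [A' = B], [B' = - A]. Then [A cos - B sin] and [A sin + B cos] are constant,
    which determines [A] and [B] from their values at [0]. *)
Lemma plane_rot_one_param (R : realType) (n : nat) (j : 'I_n)
    (M : R -> 'M[R]_n.+1) :
  M 0 = 1%:M -> (forall s t, M (s + t) = M s *m M t) ->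
  is_derive (0 : R) (1 : R) M (a_mx R j) ->
  forall t, M t = plane_rot (low j) (high j) (cos t) (sin t).
Proof.
move=> M0 MD dM0 t; apply/matrixP => i l.
have E u k h : (M u *m a_mx R j) k h =
    M u k (high j) * (h == low j)%:R - M u k (low j) * (h == high j)%:R.
  have D x y : (M u *m delta_mx x y) k h = M u k x * (h == y)%:R.
    rewrite mxE -(sum_mul_eq (fun z => M u k z * (h == y)%:R)).
    by apply: eq_bigr => z _; rewrite mxE -mulrA -natrM mulnb andbC.
  by rewrite mulmxBr mxE [X in _ + X]mxE !D.
have highlow : (high j == low j) = false.
  by apply/eqP => /(congr1 val) /= /eqP; rewrite /bump /= add1n gtn_eqF.
have dM u k h := is_derive_one_param MD dM0 u k h.
have da u : is_derive u (1 : R) (fun u => M u i (low j)) (M u i (high j)).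
  apply: is_derive_eq (dM u i (low j)) _.
  by rewrite E eqxx (eq_sym (low j)) highlow /=; ring.
have db u : is_derive u (1 : R) (fun u => M u i (high j)) (- M u i (low j)).
  apply: is_derive_eq (dM u i (high j)) _.
  by rewrite E eqxx highlow /=; ring.
pose f := (fun u => M u i (low j)) * (@cos R)
  - (fun u => M u i (high j)) * (@sin R).
pose g := (fun u => M u i (low j)) * (@sin R)
  + (fun u => M u i (high j)) * (@cos R).
have f0 : f t = f 0.
  apply: is_derive_0_is_cst => u.
  apply: is_derive_eq; rewrite /GRing.scale /=; ring.
have g0 : g t = g 0.
  apply: is_derive_0_is_cst => u.
  apply: is_derive_eq; rewrite /GRing.scale /=; ring.
move: f0 g0; rewrite /f /g !fctE /= cos0 sin0 M0 !mxE => f0 g0.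
have cs := cos2Dsin2 t.
set A := M t i (low j) in f0 g0; set B := M t i (high j) in f0 g0.
case: ifP => [/eqP -> | la]; last case: ifP => [/eqP -> | lb].
- have -> : M t i (low j) =
      cos t * (A * cos t - B * sin t) + sin t * (A * sin t + B * cos t).
    by rewrite -[LHS]mulr1 -cs -/A; ring.
  by rewrite f0 g0; ring.
- have -> : M t i (high j) =
      cos t * (A * sin t + B * cos t) - sin t * (A * cos t - B * sin t).
    by rewrite -[LHS]mulr1 -cs -/B; ring.
  by rewrite f0 g0; ring.
rewrite (_ : (i == l)%:R = M 0 i l); last by rewrite M0 mxE.
apply: (@is_derive_0_is_cst _ (fun u => M u i l)) => u.
by apply: is_derive_eq (dM u i l) _; rewrite E la lb /=; ring.
Qed.

Lemma a_mx_so (R : realType) (n : nat) (j : 'I_n) : so (a_mx R j).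
Proof. by rewrite /so /= /a_mx linearB /= !trmx_delta opprB. Qed.

(** * Bruhat cells in the covering group *)

Section Spin.
Context (R : realType) (n : nat) (G : topGroupType) (Pi : G -> SO R n.+1).
Hypothesis PiM : forall x y,
  set_val (Pi (x * y)%g) = set_val (Pi x) *m set_val (Pi y).
Context (e : 'M[R]_n.+1 -> G).
Hypothesis he : exponential_map Pi e.

Local Notation mx x := (set_val (Pi x) : 'M[R]_n.+1).

Lemma mx_orthogonal x : mx x *m (mx x)^T = 1%:M.
Proof. by have [] := set_valP (Pi x). Qed.

Lemma mx1 : mx 1%g = 1%:M.
Proof.
have := PiM 1%g 1%g; rewrite mulg1 => /(congr1 (mulmx^~ (mx 1%g)^T)).
by rewrite -mulmxA mx_orthogonal mulmx1.
Qed.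

Lemma alphaD (j : 'I_n) s t : alpha e j (s + t) = (alpha e j s * alpha e j t)%g.
Proof. by have [_ + _] := he (a_mx_so R j); apply. Qed.

Lemma alpha0 (j : 'I_n) : alpha e j 0 = 1%g.
Proof.
by apply: (mulgI (alpha e j 0)); rewrite -alphaD addr0 mulg1.
Qed.

Lemma alphaN (j : 'I_n) t : alpha e j (- t) = ((alpha e j t)^-1)%g.
Proof. by apply: (mulgI (alpha e j t)); rewrite -alphaD subrr mulgV alpha0. Qed.

Lemma mx_alpha (j : 'I_n) t :
  mx (alpha e j t) = plane_rot (low j) (high j) (cos t) (sin t).
Proof.
apply: (@plane_rot_one_param _ _ _ (fun t => mx (alpha e j t))) => [|s u|].
- by rewrite alpha0 mx1.
- by rewrite alphaD PiM.
- by have [] := he (a_mx_so R j).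
Qed.

Lemma sign_pow_acute (j : 'I_n) (b : bool) :
  sign_pow (acute e j) b = alpha e j ((-1) ^+ b * (pi / 2)).
Proof. by case: b; rewrite /= ?expr1 ?mulN1r ?expr0 ?mul1r // alphaN. Qed.

Lemma mx_sign_pow_acute (j : 'I_n) (b : bool) :
  mx (sign_pow (acute e j) b) = plane_rot (low j) (high j) 0 ((-1) ^+ b).
Proof.
rewrite sign_pow_acute mx_alpha.
by case: b; rewrite ?expr1 ?mulN1r ?expr0 ?mul1r ?cosN ?sinN
  cos_pihalf sin_pihalf.
Qed.

Lemma mx_support_word k (i : k.-tuple 'I_n) (eps : k.-tuple bool) :
  mx_support
    (mx (\prod_(l < k) sign_pow (acute e (tnth i l)) (tnth eps l))%g)
    (\prod_(l <- i) coxeter_gen l)%g.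
Proof.
rewrite big_tuple.
apply: (big_ind2 (fun (x : G) (s : 'S_n.+1) => mx_support (mx x) s)).
- rewrite mx1; apply/mx_support_diag/is_diag_mxP => x y.
  by rewrite mxE -val_eqE => /negPf ->.
- by move=> x s y t xs yt; rewrite PiM; exact: mx_supportM.
- by move=> l _; rewrite mx_sign_pow_acute; exact: mx_support_plane_rot.
Qed.

Lemma continuous_mulgr (g : G) : continuous (fun x : G => (x * g)%g).
Proof.
move=> x; apply: (@continuous2_cvg _ G G G _ _ _ _ (fun x y => (x * y)%g)).
- exact: (@mulg_continuous G (x, g)).
- exact: cvg_id.
- exact: cvg_cst.
Qed.

Lemma continuous_mulg_alpha (x : G) (j : 'I_n) (c : R) :
  continuous (fun t : R => (x * alpha e j (c * t))%g).
Proof.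
move=> t; apply: (@continuous2_cvg _ G G G _ _ _ _ (fun x y => (x * y)%g)).
- exact: (@mulg_continuous G (x, alpha e j (c * t))).
- exact: cvg_cst.
- apply: (@cvg_comp _ _ _ (fun t => c * t) (alpha e j)).
    exact: mulrl_continuous.
  by have [+ _ _] := he (a_mx_so R j); apply.
Qed.

(** The sign of the angle is that of the letter and [sin] is positive on
    [(0, pi)], so the quarter turn that appears is the one of the letter for all
    these [t] at once. *)
Lemma bruhat_SO_mul_alpha (z y : G) (w : 'S_n.+1) (j : 'I_n)
    (b : bool) (t : R) :
  mx_support (mx z) w -> ((w^-1)%g (low j) < (w^-1)%g (high j))%N ->
  0 < t < pi -> bruhat_SO (mx z) (mx y) ->
  bruhat_SO (mx (z * sign_pow (acute e j) b)%g)
    (mx (y * alpha e j ((-1) ^+ b * t))%g).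
Proof.
move=> zw wj tpi [yz _]; split; last exact: set_valP.
rewrite !PiM mx_sign_pow_acute mx_alpha.
apply: double_coset_mul_plane_rot yz => //.
- exact: mx_orthogonal.
- exact: zw.
- exact: wj.
- exact: cos2Dsin2.
- exact: sqrr_sign.
have st := sin_gt0_pi tpi.
by case: b; rewrite ?expr1 ?expr0 ?mulN1r ?mul1r ?sinN ?opprK.
Qed.

(** Every [x] in the cell of [z] is the limit as [t -> 0+] of an arc contained
    in the cell of the longer element. The double coset alone does not decide in
    which component the arc lies: it is tied to the right one by the translate
    of the whole cell of [z], a connected set that contains both the longer
    element and the point of the arc at [t = pi / 2]. *)
Lemma Bru_sub_closure (z : G) (w : 'S_n.+1) (j : 'I_n) (b : bool) :
  mx_support (mx z) w -> ((w^-1)%g (low j) < (w^-1)%g (high j))%N ->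
  Bru Pi z `<=` closure (Bru Pi (z * sign_pow (acute e j) b)%g).
Proof.
move=> zw wj x zx.
set z0 := (z * _)%g.
pose path (t : R) := (x * alpha e j ((-1) ^+ b * t))%g.
have pi0 := pi_gt0 R.
have half : 0 < (pi / 2 : R) < pi by apply/andP; split; lra.
suff path_Bru t : 0 < t < pi -> Bru Pi z0 (path t).
  move=> U xU.
  have path0 : path 0 = x by rewrite /path mulr0 alpha0 mulg1.
  have pathx : path @ (0 : R)^'+ --> x.
    by rewrite -path0; exact/cvg_at_right_filter/continuous_mulg_alpha.
  near ((0 : R)^'+) => t; exists (path t); split.
    by apply: path_Bru; apply/andP; split; near: t;
      [exact: nbhs_right_gt | exact: nbhs_right_lt].
  by near: t; exact: pathx.
have sub y u : bruhat_SO (mx z) (mx y) -> 0 < u < pi ->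
    bruhat_SO (mx z0) (mx (y * alpha e j ((-1) ^+ b * u))%g).
  by move=> ? ?; exact: bruhat_SO_mul_alpha zw wj _ _.
move=> tpi.
have zz : Bru Pi z z.
  apply: connected_component_refl; split; last exact: set_valP.
  exists 1%:M; first exact: Upplus1.
  by exists 1%:M; [exact: Upplus1|rewrite mul1mx mulmx1].
apply: (@connected_component_max _ _
  (((fun y => (y * sign_pow (acute e j) b)%g) @` Bru Pi z)
    `|` path @` `]0, pi[)).
- by left; exists z.
- move=> _ [[y zy <-]|[u u0pi <-]] /=.
    rewrite sign_pow_acute; apply: sub => //.
    exact: (connected_component_sub zy).
  apply: sub; first exact: (connected_component_sub zx).
  by move: u0pi; rewrite /= in_itv.
- apply: connectedU.
  + exists (path (pi / 2)).
    split; last by exists (pi / 2) => //=; rewrite in_itv.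
    by exists x => //; rewrite sign_pow_acute.
  + apply: connected_continuous_connected; first exact: component_connected.
    exact/continuous_subspaceT/continuous_mulgr.
  + apply: connected_continuous_connected; last first.
      exact/continuous_subspaceT/continuous_mulg_alpha.
    exact/connected_intervalP/interval_is_interval.
- by right; exists t => //=; rewrite in_itv.
Unshelve. all: by end_near. Qed.

End Spin.

Theorem corollary1p1 (R : realType) (n : nat) (hn : (2 <= n)%N)
    (G : topGroupType) (Pi : G -> SO R n.+1) (hPi : universal_covering_hom Pi)
    (expG : 'M[R]_n.+1 -> G) (hexp : exponential_map Pi expG)
    (k : nat) (i : k.-tuple 'I_n) (j : 'I_n)
    (hi : reduced_word i) (hij : reduced_word (rcons i j))
    (eps : k.-tuple bool) (epsj : bool) (q : G) (hq : Quat Pi q) :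
  let z1 : G :=
    (\prod_(l < k) sign_pow (acute expG (tnth i l)) (tnth eps l))%g in
  let z0 : G := (z1 * sign_pow (acute expG j) epsj)%g in
  closure (Bru Pi (q * z1)%g) `<=` closure (Bru Pi (q * z0)%g).
Proof.
move=> z1 z0; have [PiM _ _] := hPi.
rewrite [X in _ `<=` X](iffLR (closure_id _)); last exact: closed_closure.
apply: closureS; rewrite /z0 mulgA.
apply: (Bru_sub_closure PiM hexp (w := (\prod_(l <- i) coxeter_gen l)%g)).
  rewrite -[X in mx_support _ X]mul1g PiM; apply: mx_supportM.
    by apply: mx_support_diag; case: hq.
  exact: (mx_support_word PiM hexp).
apply: inv_perm_mul_coxeter_gen.
by rewrite -big_rcons hi hij size_rcons.
Qed.
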